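(* Let $n\ge3$, let $S$ be a scheme, $R$ an $\mathcal{O}_S$-algebra, $I$ an $R$-module, $Q$ a locally free rank $2$ $\mathcal{O}_S$-module quotient of $I$, and $\phi:\operatorname{Sym}_{n-2}Q\cong R/\mathcal{O}_S$ an isomorphism of $\mathcal{O}_S$-modules. If the map $$\operatorname{Sym}_{n-1}Q\otimes\ker(I\to Q)\to\wedge^2Q,\qquad q_1\cdots q_{n-1}\otimes k\mapsto q_1\wedge\big(\phi(q_2\cdots q_{n-1})\circ k\big)$$ is the zero map, then the map $$\operatorname{Sym}_nQ\to\wedge^2Q,\qquad q_1\cdots q_n\mapsto q_1\wedge\big(\phi(q_2\cdots q_{n-1})\circ\tilde{q}_n\big)$$ is well-defined, where $q\mapsto\tilde{q}$ denotes a fixed splitting $Q\to I$ of the quotient map. In particular the map $\operatorname{Sym}_nQ\to\wedge^2Q$ does not depend on the choice of this splitting.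
   Context: $\operatorname{Sym}_mQ$ is the submodule of symmetric tensors in $Q^{\otimes m}$. The notation $q_1\cdots q_m$ stands for an element of $\operatorname{Sym}_mQ\subset Q^{\otimes m}$ written (as a sum of) tensors $q_1\otimes\cdots\otimes q_m$; the formulas mean: use the inclusions $\operatorname{Sym}_{n-1}Q\subset Q\otimes\operatorname{Sym}_{n-2}Q$ and $\operatorname{Sym}_nQ\subset Q\otimes\operatorname{Sym}_{n-2}Q\otimes Q$ and apply the indicated operation linearly. The symbol $\circ$ denotes the action of $R$ on $I$ followed by the quotient $I\to Q$. To act on elements of $I$ by $\phi(\cdot)\in R/\mathcal{O}_S$ one lifts to $R$; on $\ker(I\to Q)$ the result in $Q$ does not depend on the lift. ''Well-defined'' in the second map means that the resulting map is independent of the ($\mathcal{O}_S$-linear) lift $\operatorname{Sym}_{n-2}Q\to R$ of $\phi$ as well as of the splitting $Q\to I$ (lifts and splittings may be chosen locally on $S$). *)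

(* Defs.v *)
From HB Require Import structures.
From mathcomp Require Import all_boot all_order all_fingroup all_algebra.
From mathcomp Require Import boolp classical_sets functions topology.

Set Implicit Arguments.
Unset Strict Implicit.
Unset Printing Implicit Defensive.

Import GRing.Theory.
Local Open Scope classical_set_scope.
Local Open Scope ring_scope.

Record opens (T : topologicalType) := Opens { oset :> set T; osetP : open oset }.

Definition openT (T : topologicalType) : opens T := Opens (@openT T).

Definition sub_openT (T : topologicalType) (U : opens T) : U `<=` openT T :=
  @subsetT T U.

Section Sheaf.
Context (T : topologicalType) (F : opens T -> Type).
Context (res : forall U V : opens T, V `<=` U -> F U -> F V).

Definition functorial :=
  (forall (U : opens T) (UU : U `<=` U) (s : F U), res UU s = s) /\
  (forall (U V W : opens T) (VU : V `<=` U) (WV : W `<=` V) (WU : W `<=` U)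
     (s : F U), res WV (res VU s) = res WU s).

(* The empty cover of the empty set is allowed: F has exactly one section    *)
(* over the empty set, so the rings O(U) below may be zero, and the          *)
(* structures used are those of comPzRingType and lmodType.                  *)
Definition gluing :=
  forall (U : opens T) (J : Type) (V : J -> opens T)
    (VU : forall j, V j `<=` U), U `<=` \bigcup_j V j ->
  forall s : forall j, F (V j),
    (forall i j (W : opens T) (Wi : W `<=` V i) (Wj : W `<=` V j),
      res Wi (s i) = res Wj (s j)) ->
  exists! t : F U, forall j, res (VU j) t = s j.

End Sheaf.

Record ringed_space := RingedSpace {
  space :> topologicalType;
  O : opens space -> comPzRingType;
  ores : forall U V : opens space, V `<=` U -> {rmorphism O U -> O V};
  ores_functorial : functorial (fun U V (VU : V `<=` U) => ores VU : O U -> O V);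
  ores_gluing : gluing (fun U V (VU : V `<=` U) => ores VU : O U -> O V) }.

Arguments O {r} U.
Arguments ores {r U V} VU.

Section Spec.
Context (A : comPzRingType).

Definition prime_ideal (P : set A) :=
  [/\ P 0, (forall x y, P x -> P y -> P (x + y)), (forall a x, P x -> P (a * x)),
      ~ P 1 & (forall x y, P (x * y) -> P x \/ P y)].

Definition Spec : set (set A) := [set P | prime_ideal P].

Definition basic_open (f : A) : set (set A) := [set P | Spec P /\ ~ P f].

Definition zariski_open (W : set (set A)) :=
  exists E : set A, W = \bigcup_(f in E) basic_open f.

End Spec.

(* g exhibits B as the localization A_f *)
Definition is_localization_at (A B : comPzRingType) (g : A -> B) (f : A) :=
  [/\ exists u, g f * u = 1,
      (forall b, exists a k, g (f ^+ k) * b = g a) &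
      (forall a, g a = 0 -> exists k, f ^+ k * a = 0)].

(* (U, O|_U) is isomorphic to Spec A.  The structure sheaf of Spec A is      *)
(* determined by its values A_f on the basic opens D(f), so an isomorphism   *)
(* is a homeomorphism h from U to Spec A together with a ring morphism       *)
(* theta : A -> O(U) which makes O(h^-1 D(f)) the localization A_f for       *)
(* every f.                                                                  *)
Definition affine (S : ringed_space) (U : opens S) :=
  exists (A : comPzRingType) (h : S -> set A) (theta : {rmorphism A -> O U}),
  [/\ set_bij U (@Spec A) h,
      (forall W : set S, W `<=` U -> (open W <-> zariski_open (h @` W))) &
      (forall (f : A) (D : opens S) (DU : D `<=` U),
        D = U `&` [set x | basic_open f (h x)] :> set S ->
        is_localization_at (ores DU \o theta) f)].

Definition is_scheme (S : ringed_space) :=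
  forall x : S, exists U : opens S, oset U x /\ affine U.

Record omodule (S : ringed_space) := OModule {
  sec :> forall U : opens S, lmodType (O U);
  res : forall U V : opens S, V `<=` U -> sec U -> sec V;
  res_linear : forall (U V : opens S) (VU : V `<=` U) a (x y : sec U),
    res VU (a *: x + y) = ores VU a *: res VU x + res VU y;
  res_functorial : functorial res;
  res_gluing : gluing res }.

Arguments res {S o U V} VU x.

(* Morphisms F|_U -> G|_U *)
Record mor_on (S : ringed_space) (U : opens S) (F G : omodule S) := MorOn {
  mor_app :> forall V : opens S, V `<=` U -> {linear F V -> G V};
  mor_res : forall (V W : opens S) (VU : V `<=` U) (WV : W `<=` V)
    (WU : W `<=` U) (x : F V), res WV (mor_app VU x) = mor_app WU (res WV x) }.

Arguments mor_app {S U F G} _ {V} VU.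

Definition mor (S : ringed_space) (F G : omodule S) := mor_on (openT S) F G.

Definition mapp (S : ringed_space) (F G : omodule S) (f : mor F G)
  (U : opens S) : {linear F U -> G U} := mor_app f (@sub_openT _ U).

Arguments mapp {S F G} f {U}.

Definition mor_restrict (S : ringed_space) (F G : omodule S) (f : mor F G)
  (U : opens S) : mor_on U F G :=
  MorOn (mor_app := fun V _ => mapp f)
    (fun V W _ WV _ x => mor_res f (@sub_openT _ V) WV (@sub_openT _ W) x).

Definition isomorphism (S : ringed_space) (F G : omodule S) (f : mor F G) :=
  forall U, bijective (@mapp S F G f U).

(* y is a section over U of the image sheaf of f *)
Definition in_image (S : ringed_space) (F G : omodule S) (f : mor F G)
    (U : opens S) (y : G U) :=
  forall x, oset U x -> exists (V : opens S) (VU : V `<=` U) (z : F V),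
    oset V x /\ mapp f z = res VU y.

Definition epi (S : ringed_space) (F G : omodule S) (f : mor F G) :=
  forall (U : opens S) (y : G U), in_image f y.

Definition locally_free (S : ringed_space) (r : nat) (F : omodule S) :=
  forall x : S, exists (U : opens S) (e : 'I_r -> F U), oset U x /\
    forall (V : opens S) (VU : V `<=` U) (y : F V),
      exists! c : 'I_r -> O V, y = \sum_i c i *: res VU (e i).

Section SubLmodule.
Context (K : pzRingType) (V : lmodType K) (P : set V).

Record sub_lmod (PC : submod_closed (mem P)) := SubLmod {
  sl_val : V;
  sl_valP : sl_val \in mem P }.

Context (PC : submod_closed (mem P)).

HB.instance Definition _ := [isSub for @sl_val PC].
HB.instance Definition _ := [Choice of sub_lmod PC by <:].
HB.instance Definition _ :=
  GRing.SubChoice_isSubLmodule.Build K V (mem P) (sub_lmod PC)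
    (GRing.submod_closed_semi PC).

End SubLmodule.

Record submodule (S : ringed_space) (F : omodule S) := Submodule {
  smem :> forall U, set (F U);
  smem_closed : forall U, submod_closed (mem (@smem U));
  smem_res : forall (U V : opens S) (VU : V `<=` U) (x : F U),
    @smem U x -> @smem V (res VU x);
  smem_local : forall (U : opens S) (J : Type) (V : J -> opens S)
    (VU : forall j, V j `<=` U), U `<=` \bigcup_j V j ->
    forall x : F U, (forall j, @smem (V j) (res (VU j) x)) -> @smem U x }.

Section SubOmodule.
Context (S : ringed_space) (F : omodule S) (P : submodule F).

Definition sub_sec (U : opens S) : lmodType (O U) := sub_lmod (smem_closed P U).

Definition sub_val (U : opens S) (x : sub_sec U) : F U := val x.

Lemma sub_valP (U : opens S) (x : sub_sec U) : P U (sub_val x).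
Proof. exact: (set_mem (valP x)). Qed.

Definition sub_mk (U : opens S) (x : F U) (Px : P U x) : sub_sec U :=
  SubLmod (smem_closed P U) (mem_set Px).

Lemma sub_val_inj (U : opens S) : injective (@sub_val U).
Proof. exact: val_inj. Qed.

Lemma sub_val_linear (U : opens S) : linear (@sub_val U).
Proof. by move=> a x y; rewrite /sub_val linearP. Qed.

Definition sub_res (U V : opens S) (VU : V `<=` U) (x : sub_sec U) : sub_sec V :=
  sub_mk (smem_res VU (sub_valP x)).

Lemma sub_res_linear (U V : opens S) (VU : V `<=` U) a (x y : sub_sec U) :
  sub_res VU (a *: x + y) = ores VU a *: sub_res VU x + sub_res VU y.
Proof.
by apply: sub_val_inj; rewrite sub_val_linear /= -res_linear -sub_val_linear.
Qed.

Lemma sub_res_functorial : functorial sub_res.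
Proof.
have [Fid Fcomp] := res_functorial F.
split=> [U UU s | U V W VU WV WU s]; apply: sub_val_inj; first exact: Fid.
exact: Fcomp.
Qed.

Lemma sub_res_gluing : gluing sub_res.
Proof.
move=> U J V VU cov s agree.
have [|t [tP tU]] := res_gluing VU cov (s := fun j => sub_val (s j)).
  by move=> i j W Wi Wj; have /(congr1 (@sub_val W)) := agree i j W Wi Wj.
have Pt : P U t.
  by apply: (@smem_local _ _ P _ _ _ VU cov) => j; rewrite tP; apply: sub_valP.
exists (sub_mk Pt); split=> [j | t' t'P]; apply: sub_val_inj; first exact: tP.
by apply: tU => j; rewrite -t'P.
Qed.

Definition sub_omodule : omodule S :=
  OModule sub_res_linear sub_res_functorial sub_res_gluing.

End SubOmodule.

Lemma res_is_linear0 (S : ringed_space) (F : omodule S) (U V : opens S)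
  (VU : V `<=` U) : res VU (0 : F U) = 0.
Proof.
have := res_linear VU 1 (0 : F U) 0.
rewrite scaler0 addr0 rmorph1 scale1r => /eqP.
by rewrite addrC -subr_eq subrr eq_sym => /eqP.
Qed.

Lemma res_inj_local (S : ringed_space) (F : omodule S) (U : opens S)
  (J : Type) (V : J -> opens S) (VU : forall j, V j `<=` U)
  (cov : U `<=` \bigcup_j V j) (x y : F U) :
  (forall j, res (VU j) x = res (VU j) y) -> x = y.
Proof.
move=> xy; have [_ Fcomp] := res_functorial F.
have [|t [_ tU]] := res_gluing VU cov (s := fun j => res (VU j) y).
  move=> i j W Wi Wj.
  rewrite (Fcomp _ _ _ _ _ (subset_trans Wi (VU i))).
  exact/esym/Fcomp.
by rewrite -(tU x) // -(tU y).
Qed.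

Section Equalizer.
Context (S : ringed_space) (F G : omodule S) (J : Type) (f g : J -> mor F G).

Definition eq_set (U : opens S) : set (F U) :=
  [set x | forall j, mapp (f j) x = mapp (g j) x].

Lemma eq_set_closed U : submod_closed (mem (@eq_set U)).
Proof.
split; first by apply/mem_set => j; rewrite !linear0.
by move=> a x y /set_mem xP /set_mem yP; apply/mem_set => j; rewrite !linearP xP yP.
Qed.

Lemma eq_set_res (U V : opens S) (VU : V `<=` U) (x : F U) :
  eq_set x -> eq_set (res VU x).
Proof.
by move=> xP j; rewrite /mapp -!(mor_res _ (@sub_openT _ U)); congr res; apply: xP.
Qed.

Lemma eq_set_local (U : opens S) (K : Type) (V : K -> opens S)
  (VU : forall j, V j `<=` U) : U `<=` \bigcup_j V j ->
  forall x : F U, (forall k, eq_set (res (VU k) x)) -> eq_set x.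
Proof.
move=> cov x xP j; apply: (@res_inj_local _ G _ _ _ VU cov) => k.
rewrite /mapp !(mor_res _ _ _ (@sub_openT _ (V k))); exact: xP.
Qed.

Definition equalizer : submodule F :=
  Submodule eq_set_closed eq_set_res eq_set_local.

End Equalizer.

Section BasicMorphisms.
Context (S : ringed_space).

Definition zero_mor (F G : omodule S) : mor F G :=
  MorOn (U := openT S) (mor_app := fun V _ => (\0 : {linear F V -> G V}))
    (fun V W _ WV _ x => res_is_linear0 G WV).

Definition id_mor (F : omodule S) : mor F F :=
  MorOn (U := openT S) (mor_app := fun V _ => (idfun : {linear F V -> F V}))
    (fun V W _ WV _ x => erefl).

Definition kernel (F G : omodule S) (f : mor F G) : omodule S :=
  sub_omodule (equalizer (fun _ : unit => f) (fun _ : unit => zero_mor F G)).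

Definition mor_eq (U : opens S) (F G : omodule S) (f g : mor_on U F G) :=
  forall (V : opens S) (VU : V `<=` U) (x : F V), mor_app f VU x = mor_app g VU x.

(* G / im u, where im u is the image sheaf of u *)
Record cokernel (F G : omodule S) (u : mor F G) := Cokernel {
  coker :> omodule S;
  coker_proj : mor G coker;
  coker_epi : epi coker_proj;
  coker_ker : forall (U : opens S) (y : G U),
    mapp coker_proj y = 0 <-> in_image u y }.

Lemma ores_linear (U V : opens S) (VU : V `<=` U) a (x y : (O U)^o) :
  ores VU (a *: x + y) = ores VU a *: (ores VU x : (O V)^o) + ores VU y.
Proof. by rewrite rmorphD rmorphM. Qed.

Definition structure_sheaf : omodule S :=
  OModule (sec := fun U => (O U)^o) ores_linear (@ores_functorial S)
    (@ores_gluing S).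

End BasicMorphisms.

Arguments coker_proj {S F G u} c.

(* The objects below are given by their universal property over every open U, for the    *)
(* restrictions to U of O_S-modules G; every O_U-module is the restriction  *)
(* of its direct image on S, so these are the universal properties of       *)
(* tensor products and exterior squares of O_U-modules, for all U.          *)

Section Multilinear.
Context (S : ringed_space) (U : opens S).

(* linearity in the i-th argument: u, v, w agree away from i                *)
Definition multilinear (F G : omodule S) (m : nat)
    (g : forall V : opens S, V `<=` U -> ('I_m -> F V) -> G V) :=
  (forall (V : opens S) (VU : V `<=` U) (i : 'I_m) (a : O V)
      (u v w : 'I_m -> F V),
    (forall j, j != i -> u j = w j /\ v j = w j) -> w i = a *: u i + v i ->
    g V VU w = a *: g V VU u + g V VU v) /\
  (forall (V W : opens S) (VU : V `<=` U) (WV : W `<=` V) (WU : W `<=` U)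
      (q : 'I_m -> F V),
    res WV (g V VU q) = g W WU (fun i => res WV (q i))).

Definition bilinear (F G H : omodule S)
    (b : forall V : opens S, V `<=` U -> F V -> G V -> H V) :=
  [/\ forall (V : opens S) (VU : V `<=` U) a x x' y,
        b V VU (a *: x + x') y = a *: b V VU x y + b V VU x' y,
      forall (V : opens S) (VU : V `<=` U) a x y y',
        b V VU x (a *: y + y') = a *: b V VU x y + b V VU x y' &
      forall (V W : opens S) (VU : V `<=` U) (WV : W `<=` V) (WU : W `<=` U) x y,
        res WV (b V VU x y) = b W WU (res WV x) (res WV y)].

Definition alternating (F H : omodule S)
    (b : forall V : opens S, V `<=` U -> F V -> F V -> H V) :=
  forall (V : opens S) (VU : V `<=` U) x, b V VU x x = 0.

End Multilinear.

Record tensor_power (S : ringed_space) (F : omodule S) (m : nat) := TensorPower {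
  tpow :> omodule S;
  tens : forall U : opens S, ('I_m -> F U) -> tpow U;
  tens_multilinear : multilinear (U := openT S) (fun V _ => @tens V);
  tens_universal : forall (U : opens S) (G : omodule S)
    (g : forall V : opens S, V `<=` U -> ('I_m -> F V) -> G V), multilinear g ->
    let factors (h : mor_on U tpow G) :=
      forall (V : opens S) (VU : V `<=` U) q, mor_app h VU (tens q) = g V VU q in
    exists h, factors h /\ forall h', factors h' -> mor_eq h h' }.

Arguments tens {S F m} t {U} q.

Record tensor_product (S : ringed_space) (F G : omodule S) := TensorProduct {
  tprod :> omodule S;
  tmul : forall U : opens S, F U -> G U -> tprod U;
  tmul_bilinear : bilinear (U := openT S) (fun V _ => @tmul V);
  tmul_universal : forall (U : opens S) (H : omodule S)
    (b : forall V : opens S, V `<=` U -> F V -> G V -> H V), bilinear b ->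
    let factors (h : mor_on U tprod H) :=
      forall (V : opens S) (VU : V `<=` U) x y,
        mor_app h VU (tmul x y) = b V VU x y in
    exists h, factors h /\ forall h', factors h' -> mor_eq h h' }.

Arguments tmul {S F G} t {U} x y.

Record exterior_square (S : ringed_space) (F : omodule S) := ExteriorSquare {
  ext2 :> omodule S;
  wedge : forall U : opens S, F U -> F U -> ext2 U;
  wedge_bilinear : bilinear (U := openT S) (fun V _ => @wedge V);
  wedge_alternating : alternating (U := openT S) (fun V _ => @wedge V);
  wedge_universal : forall (U : opens S) (H : omodule S)
    (b : forall V : opens S, V `<=` U -> F V -> F V -> H V),
    bilinear b -> alternating b ->
    let factors (h : mor_on U ext2 H) :=
      forall (V : opens S) (VU : V `<=` U) x y,
        mor_app h VU (wedge x y) = b V VU x y in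
    exists h, factors h /\ forall h', factors h' -> mor_eq h h' }.

Arguments wedge {S F} e {U} x y.

Section TensorPowers.
Context (S : ringed_space) (Q : omodule S) (T : forall m, tensor_power Q m).

Definition tens_lift (m : nat) (U : opens S) (G : omodule S)
    (g : forall V : opens S, V `<=` U -> ('I_m -> Q V) -> G V)
    (gP : multilinear g) : mor_on U (T m) G :=
  sval (cid (tens_universal (T m) gP)).

Lemma tens_liftE (m : nat) (U : opens S) (G : omodule S)
    (g : forall V : opens S, V `<=` U -> ('I_m -> Q V) -> G V)
    (gP : multilinear g) (V : opens S) (VU : V `<=` U) q :
  mor_app (tens_lift gP) VU (tens (T m) q) = g V VU q.
Proof. by rewrite /tens_lift; case: cid => h [] /=. Qed.

Lemma tens_perm_multilinear (m : nat) (s : 'S_m) :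
  multilinear (U := openT S)
    (fun V _ (q : 'I_m -> Q V) => tens (T m) (fun i => q (s i))).
Proof.
have [tl tr] := tens_multilinear (T m); split; last first.
  by move=> V W VU WV WU q; apply: (tr _ _ VU WV WU).
move=> V VU i a u v w uvw wi.
apply: (tl V VU ((s^-1)%g i)) => [j ji|]; last by rewrite permKV.
by apply: uvw; apply: contra_neq ji => <-; rewrite permK.
Qed.

(* q_1 (x) ... (x) q_m |-> q_s(1) (x) ... (x) q_s(m) *)
Definition tens_perm (m : nat) (s : 'S_m) : mor (T m) (T m) :=
  tens_lift (tens_perm_multilinear s).

Definition Symt (m : nat) : omodule S :=
  sub_omodule (equalizer (fun s : 'S_m => tens_perm s) (fun=> id_mor (T m))).

Definition sym_val (m : nat) (U : opens S) (x : Symt m U) : T m U := sub_val x.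

(* insert h a q: the family q with a inserted at position h                 *)
Definition insert (X : Type) (m : nat) (h : 'I_m.+1) (a : X) (q : 'I_m -> X) :
    'I_m.+1 -> X :=
  fun i => if unlift h i is Some j then q j else a.

Lemma insert_multilinear (m : nat) (h : 'I_m.+1) (U : opens S) (a : Q U) :
  multilinear (fun (V : opens S) (VU : V `<=` U) (q : 'I_m -> Q V) =>
    tens (T m.+1) (insert h (res VU a) q)).
Proof.
have [tl tr] := tens_multilinear (T m.+1); split; last first.
  move=> V W VU WV WU q.
  rewrite (tr _ _ (@sub_openT _ V) WV (@sub_openT _ W)).
  congr (tens _ _); apply/funext => i; rewrite /insert; case: unlift => // .
  by have [_ Fcomp] := res_functorial Q; apply: Fcomp.
move=> V VU i c u v w uvw wi.
apply: (tl V (@sub_openT _ V) (lift h i)); last by rewrite /insert liftK.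
move=> j; rewrite /insert; case: unliftP => [k ->|-> //].
by rewrite (inj_eq lift_inj); apply: uvw.
Qed.

Definition tens_insert (m : nat) (h : 'I_m.+1) (U : opens S) (a : Q U)
    (x : T m U) : T m.+1 U :=
  mor_app (tens_lift (insert_multilinear h a)) (@subset_refl _ U) x.

(* a (x) x and x (x) a *)
Definition lcat (m : nat) (U : opens S) (a : Q U) (x : T m U) : T m.+1 U :=
  tens_insert ord0 a x.

Definition rcat (m : nat) (U : opens S) (x : T m U) (a : Q U) : T m.+1 U :=
  tens_insert ord_max a x.

End TensorPowers.

(* Multiplication and action are O_S-bilinear operations on O_S-modules, so *)
(* that O_S is central in R and acts on an R-module through R.  The library *)
(* type algType would exclude R(U) = 0.                                     *)
Record oalgebra (S : ringed_space) := OAlgebra {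
  alg :> omodule S;
  amul : forall U : opens S, alg U -> alg U -> alg U;
  aone : forall U : opens S, alg U;
  amul_bilinear : bilinear (U := openT S) (fun V _ => @amul V);
  amulA : forall U, associative (@amul U);
  amul1 : forall U, left_id (aone U) (@amul U);
  a1mul : forall U, right_id (aone U) (@amul U);
  aone_res : forall (U V : opens S) (VU : V `<=` U), res VU (aone U) = aone V }.

Arguments amul {S o U} x y : rename.
Arguments aone {S} _ U.

Record rmodule (S : ringed_space) (R : oalgebra S) := RModule {
  rmod :> omodule S;
  act : forall U : opens S, R U -> rmod U -> rmod U;
  act_bilinear : bilinear (U := openT S) (fun V _ => @act V);
  act1 : forall U (x : rmod U), act (aone R U) x = x;
  actA : forall U (r s : R U) (x : rmod U), act (amul r s) x = act r (act s x) }.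

Arguments act {S R} _ {U} _ _.

Section AlgebraUnit.
Context (S : ringed_space) (R : oalgebra S).

Definition aunit_fun (U : opens S) (a : structure_sheaf S U) : R U :=
  (a : O U) *: aone R U.

Lemma aunit_linear U : linear (@aunit_fun U).
Proof. by move=> a x y; rewrite /aunit_fun scalerDl scalerA. Qed.

HB.instance Definition _ U :=
  GRing.isLinear.Build (O U) (structure_sheaf S U) (R U) _ (@aunit_fun U)
    (@aunit_linear U).

Lemma aunit_res (U V : opens S) (VU : V `<=` U) (a : structure_sheaf S U) :
  res VU (aunit_fun a) = aunit_fun (res VU a).
Proof.
have := res_linear VU (a : O U) (aone R U) 0.
by rewrite !addr0 res_is_linear0 addr0 aone_res.
Qed.

Definition aunit : mor (structure_sheaf S) R :=
  MorOn (U := openT S)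
    (mor_app := fun V _ => (@aunit_fun V : {linear structure_sheaf S V -> R V}))
    (fun V W _ WV _ a => aunit_res WV a).

End AlgebraUnit.

Section Maps.
Context (S : ringed_space) (R : oalgebra S) (I : rmodule R) (Q : omodule S)
  (pi : mor I Q) (T : forall m, tensor_power Q m) (W : exterior_square Q)
  (C : cokernel (aunit R)) (m : nat) (phi : mor (Symt T m) C).

Definition is_lift (U : opens S) (f : mor_on U (Symt T m) R) :=
  forall (V : opens S) (VU : V `<=` U) (x : Symt T m V),
    mapp (coker_proj C) (mor_app f VU x) = mapp phi x.

Definition is_splitting (U : opens S) (s : mor_on U Q I) :=
  forall (V : opens S) (VU : V `<=` U) (q : Q V), mapp pi (mor_app s VU q) = q.

(* With n = m + 2: mu is the map                                            *)
(*   q_1 ... q_(n-1) (x) k |-> q_1 /\ (phi(q_2 ... q_(n-1)) o k).           *)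
(* A section t of Sym_(n-1) Q is locally a sum of a_i (x) x_i with x_i in   *)
(* Sym_(n-2) Q, and phi(x_i) acts on k through any lift r_i to R.           *)
Definition is_first_map (P : tensor_product (Symt T m.+1) (kernel pi))
    (mu : mor P W) :=
  forall (V : opens S) (t : Symt T m.+1 V) (k : kernel pi V) (N : nat)
    (a : 'I_N -> Q V) (x : 'I_N -> Symt T m V) (r : 'I_N -> R V),
    (forall i, mapp (coker_proj C) (r i) = mapp phi (x i)) ->
    sym_val t = \sum_i lcat (a i) (sym_val (x i)) ->
    mapp mu (tmul P t k) =
      \sum_i wedge W (a i) (mapp pi (act I (r i) (sub_val k))).

(* Psi is, over U, the map                                                  *)
(*   q_1 ... q_n |-> q_1 /\ (f(q_2 ... q_(n-1)) o s(q_n))                   *)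
(* given by the lift f and the splitting s.  A section t of Sym_n Q is      *)
(* locally a sum of a_i (x) x_i (x) b_i with x_i in Sym_(n-2) Q.            *)
Definition is_second_map (U : opens S) (f : mor_on U (Symt T m) R) (s : mor_on U Q I)
    (Psi : mor_on U (Symt T m.+2) W) :=
  forall (V : opens S) (VU : V `<=` U) (t : Symt T m.+2 V) (N : nat)
    (a : 'I_N -> Q V) (x : 'I_N -> Symt T m V) (b : 'I_N -> Q V),
    sym_val t = \sum_i lcat (a i) (rcat (sym_val (x i)) (b i)) ->
    mor_app Psi VU t =
      \sum_i wedge W (a i) (mapp pi (act I (mor_app f VU (x i)) (mor_app s VU (b i)))).

(* Psi is given over every open U by the second formula, whatever the lift   *)
(* and the splitting over U                                                  *)
Definition is_second_map_for_all_choices (Psi : mor (Symt T m.+2) W) :=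
  forall (U : opens S) (f : mor_on U (Symt T m) R) (s : mor_on U Q I),
    is_lift f -> is_splitting s -> is_second_map f s (mor_restrict Psi U).

End Maps.

(* Main.v *)
From HB Require Import structures.
From mathcomp Require Import all_boot all_fingroup all_algebra.
From mathcomp Require Import boolp classical_sets functions topology.
Require Import Defs.

(* Over an open set where Q has a basis e, contracting the outer slots of a
   symmetric tensor t with the dual basis yields symmetric tensors t_jl = t_lj
   with t = sum_jl e_j (x) t_jl (x) e_l, and the formula of the second map at
   any expression of t equals sum_jl e_j /\ (phi(t_jl) o s(e_l)).  Two lifts of
   phi(t_jl) differ locally by sections c_jl = c_lj of O_S, which changes this
   sum by sum_jl c_jl e_j /\ e_l = 0.  Two splittings differ at e_l by a section
   k_l of ker(I -> Q), which changes it by the sum over l of the values of the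
   first map at (sum_j e_j (x) t_jl) (x) k_l, where sum_j e_j (x) t_jl is again
   a contraction of t, hence symmetric.  So the local values glue.  Lifts and
   splittings exist locally because Q is locally free and Sym_m Q has, locally,
   a finite system of generators with linear coordinates: the orbit sums of the
   words e_K(1) (x) ... (x) e_K(m). *)

Set Implicit Arguments.
Unset Strict Implicit.
Unset Printing Implicit Defensive.

Import GRing.Theory.
Local Open Scope classical_set_scope.
Local Open Scope ring_scope.

(** * Linearity of plain functions, for partial applications without a canonical linear structure *)

Section LinearMap.
Context (K : pzRingType) (A B : lmodType K) (f : A -> B) (f_linear : linear f).

Definition linear_map : {linear A -> B} :=
  HB.pack f (GRing.isLinear.Build K A B *:%R f f_linear).

Lemma linear_mapD x y : f (x + y) = f x + f y.
Proof. exact: (linearD linear_map). Qed.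

Lemma linear_mapB x y : f (x - y) = f x - f y.
Proof. exact: (linearB linear_map). Qed.

Lemma linear_mapZ a x : f (a *: x) = a *: f x.
Proof. exact: (linearZ_LR linear_map). Qed.

Lemma linear_map_sum (J : Type) (r : seq J) (F : J -> A) :
  f (\sum_(j <- r) F j) = \sum_(j <- r) f (F j).
Proof. exact: (linear_sum linear_map). Qed.

End LinearMap.

(** * Restriction of sections, and operations on morphisms over an open set *)

Section Morphisms.
Context (S : ringed_space).
Implicit Types U V : opens S.

Definition opensI U V : opens S := Opens (openI (osetP U) (osetP V)).

Lemma res_refl (F : omodule S) U (UU : U `<=` U) (x : F U) : res UU x = x.
Proof. by have [h _] := res_functorial F; apply: h. Qed.

Lemma res_trans (F : omodule S) U V V' (VU : V `<=` U) (V'V : V' `<=` V)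
  (V'U : V' `<=` U) (x : F U) : res V'V (res VU x) = res V'U x.
Proof. by have [_ h] := res_functorial F; apply: h. Qed.

Lemma ores_trans U V V' (VU : V `<=` U) (V'V : V' `<=` V)
  (V'U : V' `<=` U) (a : O U) : ores V'V (ores VU a) = ores V'U a.
Proof. by have [_ h] := ores_functorial S; apply: h. Qed.

Lemma ores_refl U (UU : U `<=` U) (a : O U) : ores UU a = a.
Proof. by have [h _] := ores_functorial S; apply: h. Qed.

Lemma resD (F : omodule S) U V (VU : V `<=` U) (x y : F U) :
  res VU (x + y) = res VU x + res VU y.
Proof. by rewrite -[x]scale1r res_linear rmorph1 !scale1r. Qed.

Lemma res_sum (F : omodule S) U V (VU : V `<=` U) J (r : seq J) (A : pred J)
    (x : J -> F U) :
  res VU (\sum_(j <- r | A j) x j) = \sum_(j <- r | A j) res VU (x j).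
Proof.
exact: (big_morph _ (resD VU) (res_is_linear0 _ _)).
Qed.

Lemma resZ (F : omodule S) U V (VU : V `<=` U) a (x : F U) :
  res VU (a *: x) = ores VU a *: res VU x.
Proof. by rewrite -[_ *: x]addr0 res_linear res_is_linear0 addr0. Qed.

Lemma mapp_res (F G : omodule S) (f : mor F G) U V (VU : V `<=` U) (x : F U) :
  res VU (mapp f x) = mapp f (res VU x).
Proof. exact: mor_res. Qed.

Definition mk_mor U (F G : omodule S) (f : forall V, V `<=` U -> F V -> G V)
    (f_linear : forall V (VU : V `<=` U), linear (f V VU))
    (f_res : forall V V' (VU : V `<=` U) (V'V : V' `<=` V) (V'U : V' `<=` U) x,
      res V'V (f V VU x) = f V' V'U (res V'V x)) : mor_on U F G :=
  MorOn (mor_app := fun V VU => linear_map (f_linear V VU)) f_res.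

Section Combinators.
Context (U : opens S) (F G H : omodule S).

Definition comp_mor (g : mor_on U G H) (f : mor_on U F G) : mor_on U F H.
Proof.
apply: (@mk_mor _ _ _ (fun V VU x => mor_app g VU (mor_app f VU x))).
  by move=> V VU a x y /=; rewrite 2!linearP.
by move=> V V' VU V'V V'U x /=; rewrite (mor_res _ _ _ V'U) (mor_res _ _ _ V'U).
Defined.

(** Expresses linearity of an insertion in the inserted vector as an equality of morphisms, which
    can be tested on pure tensors. *)
Definition comb_mor (c : O U) (f g : mor_on U F G) : mor_on U F G.
Proof.
apply: (@mk_mor _ _ _
  (fun V VU x => ores VU c *: mor_app f VU x + mor_app g VU x)).
  move=> V VU a x y /=; rewrite 2!linearP !scalerDr !scalerA [in RHS]mulrC.
  by rewrite -!addrA; congr (_ + _); rewrite addrCA.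
move=> V V' VU V'V V'U x.
by rewrite res_linear (ores_trans _ _ V'U) !(mor_res _ _ _ V'U).
Defined.

Definition sum_mor (J : Type) (r : seq J) (f : J -> mor_on U F G) : mor_on U F G.
Proof.
apply: (@mk_mor _ _ _ (fun V VU x => \sum_(j <- r) mor_app (f j) VU x)).
  move=> V VU a x y /=; rewrite scaler_sumr -big_split.
  by apply: eq_bigr => j _; rewrite linearP.
move=> V V' VU V'V V'U x /=; rewrite res_sum.
by apply: eq_bigr => j _; rewrite (mor_res _ _ _ V'U).
Defined.

(** For c = 1 this is the identity over U; a decomposition of x then becomes an equality of
    morphisms. *)
Definition scalar_mor (c : O U) : mor_on U F F.
Proof.
apply: (@mk_mor _ _ _ (fun V VU x => ores VU c *: x)).
  by move=> V VU a x y /=; rewrite !scalerDr !scalerA mulrC.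
by move=> V V' VU V'V V'U x /=; rewrite resZ (ores_trans _ _ V'U).
Defined.

(** Sums of such maps build the local splittings and lifts out of coordinates and chosen
    preimages. *)
Definition line_mor (c : mor_on U F (structure_sheaf S)) (z : G U) : mor_on U F G.
Proof.
apply: (@mk_mor _ _ _ (fun V VU x => (mor_app c VU x : O V) *: res VU z)).
  by move=> V VU a x y /=; rewrite linearP scalerDl scalerA.
move=> V V' VU V'V V'U x /=; rewrite resZ (res_trans _ _ V'U); congr (_ *: _).
exact: (mor_res c VU V'V V'U x).
Defined.

Definition sub_mor V (VU : V `<=` U) (f : mor_on U F G) : mor_on V F G.
Proof.
apply: (@mk_mor _ _ _ (fun V' V'V x => mor_app f (subset_trans V'V VU) x)).
  by move=> V' V'V a x y; rewrite linearP.
by move=> V1 V2 V1V V21 V2V x; apply: mor_res.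
Defined.

End Combinators.

End Morphisms.
Arguments scalar_mor {S U F} c.

(** * Tensor powers: testing on pure tensors, insertion of a factor, multilinear expansion *)

Section Tensors.
Context (S : ringed_space) (Q : omodule S) (T : forall m, tensor_power Q m).
Implicit Types U V : opens S.

Lemma tens_linear m U (i : 'I_m) (a : O U) (u v w : 'I_m -> Q U) :
  (forall j, j != i -> u j = w j /\ v j = w j) -> w i = a *: u i + v i ->
  tens (T m) w = a *: tens (T m) u + tens (T m) v.
Proof. by have [h _] := tens_multilinear (T m); apply: (h U (@sub_openT _ U)). Qed.

Lemma tens_res m U V (VU : V `<=` U) (q : 'I_m -> Q U) :
  res VU (tens (T m) q) = tens (T m) (fun i => res VU (q i)).
Proof.
have [_ h] := tens_multilinear (T m).
exact: (h U V (@sub_openT _ U) VU (@sub_openT _ V)).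
Qed.

(** Both morphisms factor the same multilinear map, so the uniqueness in the universal property over
    U applies. *)
Lemma tens_ext m U (G : omodule S) (h h' : mor_on U (T m) G) :
  (forall V (VU : V `<=` U) q,
    mor_app h VU (tens (T m) q) = mor_app h' VU (tens (T m) q)) ->
  mor_eq h h'.
Proof.
move=> hh'.
have gP : multilinear (fun V VU (q : 'I_m -> Q V) => mor_app h VU (tens (T m) q)).
  split=> [V VU i a u v w uvw wi | V V' VU V'V V'U q].
    by rewrite (tens_linear uvw wi) linearP.
  by rewrite (mor_res _ _ _ V'U) tens_res.
have [k [_ kU]] := tens_universal (T m) gP.
have kh := kU h (fun V VU q => erefl).
have kh' := kU h' (fun V VU q => esym (hh' V VU q)).
by move=> V VU x; rewrite -kh -kh'.
Qed.

Lemma mor_irr U V (VU VU' : V `<=` U) (F G : omodule S) (f : mor_on U F G) x :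
  mor_app f VU x = mor_app f VU' x.
Proof. by rewrite (Prop_irrelevance VU VU'). Qed.

Lemma tens_permE m (s : 'S_m) U (q : 'I_m -> Q U) :
  mapp (tens_perm T s) (tens (T m) q) = tens (T m) (fun i => q (s i)).
Proof. exact: tens_liftE. Qed.

Lemma insertK X m (h : 'I_m.+1) (q : 'I_m.+1 -> X) :
  insert h (q h) (fun i => q (lift h i)) = q.
Proof. by apply/funext => i; rewrite /insert; case: unliftP => [j ->|->]. Qed.

Lemma insert_at X m (h : 'I_m.+1) a (q : 'I_m -> X) : insert h a q h = a.
Proof. by rewrite /insert unlift_none. Qed.

Lemma insert_lift X m (h : 'I_m.+1) a (q : 'I_m -> X) i :
  insert h a q (lift h i) = q i.
Proof. by rewrite /insert liftK. Qed.

Definition ins_mor m (h : 'I_m.+1) U (a : Q U) : mor_on U (T m) (T m.+1) :=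
  tens_lift T (insert_multilinear T h a).

Lemma tens_insert_tens m (h : 'I_m.+1) U (a : Q U) (q : 'I_m -> Q U) :
  tens_insert h a (tens (T m) q) = tens (T m.+1) (insert h a q).
Proof. by rewrite /tens_insert tens_liftE res_refl. Qed.

(** The insertions over U and over V come from separate uses of the universal property; they agree
    on pure tensors. *)
Lemma tens_insert_res m (h : 'I_m.+1) U V (VU : V `<=` U) (a : Q U) (x : T m U) :
  res VU (tens_insert h a x) = tens_insert h (res VU a) (res VU x).
Proof.
rewrite /tens_insert (mor_res _ _ _ VU).
suff /(_ V (@subset_refl _ V) (res VU x)) :
    mor_eq (sub_mor VU (ins_mor h a)) (ins_mor h (res VU a)).
  by rewrite /= => <-; apply: mor_irr.
apply: tens_ext => V' V'V q /=; rewrite !tens_liftE.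
by rewrite (res_trans _ _ (subset_trans V'V VU)).
Qed.

Lemma tens_insert_linear m (h : 'I_m.+1) U (a : Q U) :
  linear (fun x : T m U => tens_insert h a x).
Proof. by move=> c x y; rewrite /tens_insert linearP. Qed.

Lemma tens_insert_linearl m (h : 'I_m.+1) U (x : T m U) :
  linear (fun a : Q U => tens_insert h a x).
Proof.
move=> c a b; rewrite /tens_insert.
suff /(_ U (@subset_refl _ U) x) : mor_eq (ins_mor h (c *: a + b))
    (comb_mor c (ins_mor h a) (ins_mor h b)).
  by rewrite /= ores_refl.
apply: tens_ext => V VU q /=; rewrite !tens_liftE.
apply: (tens_linear (i := h)) => [j|]; last by rewrite !insert_at res_linear.
by case: (unliftP h j) => [k ->|->]; rewrite ?eqxx // !insert_lift.
Qed.

(** Induction on m, splitting off slot 0. *)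
Lemma tens_multilinear_sum m U (J : finType) (c : 'I_m -> J -> O U)
    (e : J -> Q U) :
  tens (T m) (fun i => \sum_j c i j *: e j) =
  \sum_(K : {ffun 'I_m -> J}) (\prod_i c i (K i)) *: tens (T m) (fun i => e (K i)).
Proof.
elim: m c => [|m IH] c.
  (* For m = 0 the only index is the empty family, with empty product 1. *)
  rewrite (bigD1 [ffun i : 'I_0 => False_rect J (notF (ltn_ord i))]) //=.
  rewrite big_ord0 scale1r [X in _ + X]big1 ?addr0 => [|K].
    by congr tens; apply/funext => -[].
  by case/eqP; apply/ffunP => -[].
rewrite -[LHS](congr1 _ (insertK ord0 _)) -tens_insert_tens IH.
rewrite (linear_map_sum (tens_insert_linear _ _)).
(* A word of length m + 1 is a first letter together with a word of length m. *)
pose cons (p : J * {ffun 'I_m -> J}) : {ffun 'I_m.+1 -> J} :=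
  [ffun i => insert ord0 p.1 p.2 i].
rewrite (reindex cons) /=; last first.
  exists (fun K : {ffun 'I_m.+1 -> J} => (K ord0, [ffun i => K (lift ord0 i)])).
    move=> [j K] _; rewrite /cons /=; congr pair; first by rewrite ffunE insert_at.
    by apply/ffunP => i; rewrite !ffunE insert_lift.
  move=> K _; apply/ffunP => i; rewrite ffunE /=.
  by rewrite -[RHS](congr1 (fun f => f i) (insertK ord0 K)) /insert;
    case: unlift => // j; rewrite ffunE.
rewrite -(pair_bigA _ (fun j K => (\prod_i c i (cons (j, K) i)) *:
  tens (T m.+1) (fun i => e (cons (j, K) i)))) exchange_big /=.
apply: eq_bigr => K _.
rewrite (linear_mapZ (tens_insert_linear _ _)).
rewrite (linear_map_sum (tens_insert_linearl _ _)) scaler_sumr.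
apply: eq_bigr => j _; rewrite (linear_mapZ (tens_insert_linearl _ _)) scalerA.
rewrite tens_insert_tens mulrC big_ord_recl; congr (_ * _ *: tens _ _).
- by rewrite ffunE insert_at.
- by apply: eq_bigr => i _; rewrite ffunE insert_lift.
by apply/funext => i; rewrite ffunE /insert; case: unlift.
Qed.

End Tensors.

(** * Bases over an open set, coordinates, and contraction of tensor slots *)

Definition is_basis (S : ringed_space) (F : omodule S) (U : opens S) (r : nat)
    (e : 'I_r -> F U) :=
  forall (V : opens S) (VU : V `<=` U) (y : F V),
    exists! c : 'I_r -> O V, y = \sum_i c i *: res VU (e i).

Lemma is_basis_res (S : ringed_space) (F : omodule S) (U V : opens S)
    (VU : V `<=` U) (r : nat) (e : 'I_r -> F U) :
  is_basis e -> is_basis (fun i => res VU (e i)).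
Proof.
move=> eP V' V'V y; have := eP V' (subset_trans V'V VU) y.
by under eq_fun do under eq_bigr do rewrite -(res_trans VU V'V).
Qed.

Section Basis.
Context (S : ringed_space) (Q : omodule S) (T : forall m, tensor_power Q m).
Context (U : opens S) (r : nat) (e : 'I_r -> Q U) (eP : is_basis e).
Implicit Types V : opens S.

Definition coordinate V (VU : V `<=` U) (y : Q V) : 'I_r -> O V :=
  sval (cid (eP VU y)).

Lemma coordE V (VU : V `<=` U) (y : Q V) :
  y = \sum_j coordinate VU y j *: res VU (e j).
Proof. by rewrite /coordinate; case: cid => c []. Qed.

Lemma coordE1 (y : Q U) : y = \sum_j coordinate (@subset_refl _ U) y j *: e j.
Proof.
rewrite {1}[y](coordE (@subset_refl _ U)).
by apply: eq_bigr => j _; rewrite res_refl.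
Qed.

Lemma coord_unique V (VU : V `<=` U) (y : Q V) (c : 'I_r -> O V) :
  y = \sum_j c j *: res VU (e j) -> coordinate VU y = c.
Proof. by rewrite /coordinate; case: cid => d [_ dU] /= /dU. Qed.

Lemma coord_linear V (VU : V `<=` U) a (x y : Q V) j :
  coordinate VU (a *: x + y) j = a * coordinate VU x j + coordinate VU y j.
Proof.
rewrite (@coord_unique _ _ _ (fun j => a * coordinate VU x j + coordinate VU y j)) //.
rewrite {1}[x](coordE VU) {1}[y](coordE VU) scaler_sumr -big_split.
by apply: eq_bigr => k _; rewrite scalerDl scalerA.
Qed.

Lemma coord_res V V' (VU : V `<=` U) (V'V : V' `<=` V) (V'U : V' `<=` U) (x : Q V) j :
  ores V'V (coordinate VU x j) = coordinate V'U (res V'V x) j.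
Proof.
rewrite (@coord_unique _ V'U _ (fun j => ores V'V (coordinate VU x j))) //.
rewrite {1}[x](coordE VU) res_sum; apply: eq_bigr => k _.
by rewrite resZ (res_trans _ _ V'U).
Qed.

Definition coord_mor (j : 'I_r) : mor_on U Q (structure_sheaf S) :=
  @mk_mor S U Q (structure_sheaf S) (fun V VU y => coordinate VU y j)
    (fun V VU a x y => coord_linear VU a x y j)
    (fun V V' VU V'V V'U x => coord_res VU V'V V'U x j).

(** Linearity in slot h comes from the coordinate, linearity in any other slot from the remaining
    tensor. *)
Lemma contr_multilinear m (h : 'I_m.+1) (j : 'I_r) :
  multilinear (fun V (VU : V `<=` U) (q : 'I_m.+1 -> Q V) =>
    coordinate VU (q h) j *: tens (T m) (fun i => q (lift h i))).
Proof.
split=> [V VU i a u v w uvw wi | V V' VU V'V V'U q]; last first.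
  by rewrite resZ tens_res (coord_res _ _ V'U).
case: (unliftP h i) => [k ik|ih].
  have [-> ->] : u h = w h /\ v h = w h by apply: uvw; rewrite ik neq_lift.
  rewrite scalerA mulrC -scalerA -scalerDr; congr (_ *: _).
  apply: (tens_linear T (i := k)) => [l lk|]; last by rewrite -ik.
  by apply: uvw; rewrite ik (inj_eq lift_inj).
have uw l : u (lift h l) = w (lift h l) /\ v (lift h l) = w (lift h l).
  by apply: uvw; rewrite ih eq_sym neq_lift.
rewrite -ih wi coord_linear scalerDl scalerA ih.
by congr (_ *: tens _ _ + _ *: tens _ _); apply/funext => l; case: (uw l).
Qed.

(** The contraction of slot h with the j-th vector of the dual basis. *)
Definition contr m (h : 'I_m.+1) (j : 'I_r) : mor_on U (T m.+1) (T m) :=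
  tens_lift T (contr_multilinear h j).

Lemma contr_tens m (h : 'I_m.+1) j V (VU : V `<=` U) (q : 'I_m.+1 -> Q V) :
  mor_app (contr h j) VU (tens (T m.+1) q) =
  coordinate VU (q h) j *: tens (T m) (fun i => q (lift h i)).
Proof. exact: tens_liftE. Qed.

Let UU := @subset_refl _ U.

Lemma contr_insert m (h : 'I_m.+1) j (a : Q U) (x : T m U) :
  mor_app (contr h j) UU (tens_insert h a x) = coordinate UU a j *: x.
Proof.
suff /(_ U UU x) : mor_eq (comp_mor (contr h j) (ins_mor T h a))
    (scalar_mor (coordinate UU a j)) by rewrite /= ores_refl.
apply: tens_ext => V VU q /=.
rewrite tens_liftE contr_tens insert_at (coord_res _ _ VU).
by congr (_ *: tens _ _); apply/funext => i; rewrite insert_lift.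
Qed.

(** On pure tensors this is the expansion of the factor in slot h in the basis. *)
Lemma insert_contr m (h : 'I_m.+1) (x : T m.+1 U) :
  x = \sum_j tens_insert h (e j) (mor_app (contr h j) UU x).
Proof.
suff /(_ U UU x) : mor_eq (scalar_mor 1)
    (sum_mor (index_enum 'I_r)
      (fun j => comp_mor (ins_mor T h (e j)) (contr h j))).
  by rewrite /= rmorph1 scale1r.
apply: tens_ext => V VU q /=; rewrite rmorph1 scale1r.
under eq_bigr => j _.
  rewrite contr_tens linearZ /= tens_liftE -tens_insert_tens.
  rewrite -(linear_mapZ (tens_insert_linearl _ _)) /=.
  over.
rewrite -(linear_map_sum (tens_insert_linearl _ _)) /= -coordE.
by rewrite tens_insert_tens insertK.
Qed.

(** [lift_perm h h s] fixes slot h and acts as s on the others. Hence contractions of symmetric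
    tensors are symmetric, which gives [sym_contr]. *)
Lemma contr_perm m (h : 'I_m.+1) j (s : 'S_m) (x : T m.+1 U) :
  mapp (tens_perm T s) (mor_app (contr h j) UU x) =
  mor_app (contr h j) UU (mapp (tens_perm T (lift_perm h h s)) x).
Proof.
suff /(_ U UU x) : mor_eq
    (comp_mor (mor_restrict (tens_perm T s) U) (contr h j))
    (comp_mor (contr h j) (mor_restrict (tens_perm T (lift_perm h h s)) U)) by [].
apply: tens_ext => V VU q /=.
rewrite tens_permE !contr_tens linearZ /= tens_permE lift_perm_id.
by congr (_ *: tens _ _); apply/funext => i; rewrite lift_perm_lift.
Qed.

Lemma contr_swap m (j l : 'I_r) (x : T m.+2 U) :
  mor_app (contr ord_max l) UU (mor_app (contr ord0 j) UU x) =
  mor_app (contr ord_max j) UU (mor_app (contr ord0 l) UU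
    (mapp (tens_perm T (tperm ord0 ord_max)) x)).
Proof.
suff /(_ U UU x) : mor_eq
    (comp_mor (contr (@ord_max m) l) (contr ord0 j))
    (comp_mor (comp_mor (contr (@ord_max m) j) (contr ord0 l))
      (mor_restrict (tens_perm T (tperm ord0 ord_max)) U)) by [].
apply: tens_ext => V VU q /=.
(* Once slot 0 is removed, the last remaining slot is the original last slot. *)
have max_lift : lift ord0 (@ord_max m) = ord_max by apply: val_inj.
rewrite tens_permE !contr_tens !linearZ /= !contr_tens !scalerA max_lift.
rewrite tpermL tpermR mulrC; congr (_ *: tens _ _); apply/funext => i.
(* A middle slot differs from both ends, so the transposition fixes it. *)
rewrite tpermD // -?(inj_eq val_inj) //= ?/bump ?leq0n.
by rewrite add1n eqSS eq_sym leqNgt ltn_ord add0n neq_ltn ltn_ord.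
Qed.

Lemma contr_comm m (j l : 'I_r) (x : T m.+2 U) :
  mor_app (contr ord0 j) UU (mor_app (contr ord_max l) UU x) =
  mor_app (contr ord_max l) UU (mor_app (contr ord0 j) UU x).
Proof.
suff /(_ U UU x) : mor_eq
    (comp_mor (contr (@ord0 m) j) (contr ord_max l))
    (comp_mor (contr (@ord_max m) l) (contr ord0 j)) by [].
apply: tens_ext => V VU q /=.
have max_lift : lift ord0 (@ord_max m) = ord_max by apply: val_inj.
have lift_max : lift ord_max (@ord0 m) = ord0 by apply: val_inj.
rewrite !contr_tens !linearZ /= !contr_tens !scalerA max_lift lift_max mulrC.
congr (_ *: tens _ _); apply/funext => i; congr q; apply: val_inj => /=.
by rewrite /bump !leq0n !add1n ltnS leqNgt ltn_ord.
Qed.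

Definition symmetric_tensor m (x : T m U) := forall s : 'S_m, mapp (tens_perm T s) x = x.

Lemma sym_valP m (x : Symt T m U) : symmetric_tensor (sym_val x).
Proof. by move=> s; apply: (sub_valP x s). Qed.

Definition mk_sym m (x : T m U) (xP : symmetric_tensor x) : Symt T m U :=
  @sub_mk S (T m)
    (equalizer (fun s : 'S_m => tens_perm T s) (fun=> id_mor (T m))) U x xP.

Definition sym_contr m (h : 'I_m.+1) (j : 'I_r) (t : Symt T m.+1 U) : Symt T m U.
Proof.
apply: (@mk_sym m (mor_app (contr h j) UU (sym_val t))) => s.
by rewrite contr_perm sym_valP.
Defined.

Lemma sym_valE m (x y : Symt T m U) : sym_val x = sym_val y -> x = y.
Proof. exact: sub_val_inj. Qed.

Lemma sym_val_linear m : linear (@sym_val _ _ T m U).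
Proof. exact: sub_val_linear. Qed.

Lemma sym_contr_linear m (h : 'I_m.+1) (j : 'I_r) : linear (sym_contr h j).
Proof.
move=> a x y; apply: sym_valE; rewrite sym_val_linear.
change (mor_app (contr h j) UU (sym_val (a *: x + y)) =
  a *: mor_app (contr h j) UU (sym_val x) + mor_app (contr h j) UU (sym_val y)).
by rewrite sym_val_linear linearP.
Qed.

(* The t_jl with t = sum_jl e_j (x) t_jl (x) e_l. *)
Definition middle m (t : Symt T m.+2 U) (j l : 'I_r) : Symt T m U :=
  sym_contr ord0 j (sym_contr ord_max l t).

(** The transposition of the two outer slots fixes t and exchanges the roles of j and l. *)
Lemma middleC m (t : Symt T m.+2 U) j l : middle t j l = middle t l j.
Proof.
apply: sym_valE; rewrite /middle /=.
change (mor_app (contr ord0 j) UU (mor_app (contr ord_max l) UU (sym_val t)) =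
  mor_app (contr ord0 l) UU (mor_app (contr ord_max j) UU (sym_val t))).
by rewrite !contr_comm contr_swap sym_valP.
Qed.

(** Both ends of each summand contract to scalars. This carries an arbitrary expression of t over to
    the canonical one given by the basis. *)
Lemma middle_rep m (t : Symt T m.+2 U) (N : nat) (a : 'I_N -> Q U)
    (x : 'I_N -> Symt T m U) (b : 'I_N -> Q U) :
  sym_val t = \sum_i lcat (a i) (rcat (sym_val (x i)) (b i)) ->
  forall j l, middle t j l = \sum_i (coordinate UU (a i) j * coordinate UU (b i) l) *: x i.
Proof.
move=> tE j l; apply: sym_valE; rewrite (linear_map_sum (@sym_val_linear _)).
change (mor_app (contr ord0 j) UU (mor_app (contr ord_max l) UU (sym_val t)) =
  \sum_i sym_val ((coordinate UU (a i) j * coordinate UU (b i) l) *: x i)).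
rewrite contr_comm tE !linear_sum /=; apply: eq_bigr => i _.
rewrite (linear_mapZ (@sym_val_linear _)) /lcat /rcat contr_insert linearZ /=.
by rewrite contr_insert scalerA.
Qed.

Lemma sym_contr_lcat m (t : Symt T m.+1 U) :
  sym_val t = \sum_j lcat (e j) (sym_val (sym_contr ord0 j t)).
Proof. exact: insert_contr. Qed.

Lemma middle_decomp m (t : Symt T m.+2 U) :
  sym_val t = \sum_j \sum_l lcat (e j) (rcat (sym_val (middle t j l)) (e l)).
Proof.
rewrite [LHS](insert_contr ord0); apply: eq_bigr => j _.
rewrite [X in tens_insert _ _ X](insert_contr ord_max) /lcat /rcat.
rewrite (linear_map_sum (tens_insert_linear _ _)).
(* [middle] contracts the last slot first, whereas the expansion started with slot 0. *)
by apply: eq_bigr => l _; rewrite -contr_comm.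
Qed.

End Basis.

(** * Local determination and gluing of sections *)

Lemma dep_choice (X : Type) (Y : X -> Type) (P : forall x, Y x -> Prop) :
  (forall x, exists y, P x y) -> exists f : forall x, Y x, forall x, P x (f x).
Proof. by move=> PY; exists (fun x => sval (cid (PY x))) => x; case: cid. Qed.

Section Local.
Context (S : ringed_space).
Implicit Types U V : opens S.

(** The neighbourhoods cover U, so this is separatedness of the sheaf, stated point by point. *)
Lemma res_inj_pt (F : omodule S) U (y z : F U) :
  (forall x, oset U x -> exists (V : opens S) (VU : V `<=` U),
    oset V x /\ res VU y = res VU z) -> y = z.
Proof.
move=> loc.
pose J := {x : S | oset U x}.
have /dep_choice [V /dep_choice [VU VP]] : forall p : J, exists V, exists VU : V `<=` U,
    oset V (sval p) /\ res VU y = res VU z by case=> x Ux; apply: loc.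
apply: (@res_inj_local _ F U J V VU) => [x Ux|p]; last by case: (VP p).
by exists (exist _ x Ux) => //; case: (VP (exist _ x Ux)).
Qed.

(** Induction on an enumeration of J, shrinking the neighbourhood at each element; 0 serves as the
    default outside the treated part. *)
Lemma in_image_fin (F G : omodule S) (f : mor F G) U (J : finType) (y : J -> G U) :
  (forall j, in_image f (y j)) -> forall x, oset U x ->
  exists (V : opens S) (VU : V `<=` U) (z : J -> F V),
    oset V x /\ forall j, mapp f (z j) = res VU (y j).
Proof.
move=> yP x Ux.
suff [V [VU [z [Vx zP]]]] : exists V (VU : V `<=` U) (z : J -> F V),
    oset V x /\ forall j, j \in enum J -> mapp f (z j) = res VU (y j).
  by exists V, VU, z; split=> // j; apply: zP; rewrite mem_enum.
elim: (enum J) => [|i s [V [VU [z [Vx zP]]]]].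
  by exists U, (@subset_refl _ U), (fun=> 0).
have [V' [V'U [w [V'x wP]]]] := yP i x Ux.
pose V2 := opensI V V'.
have V2V : V2 `<=` V by move=> ? [].
have V2V' : V2 `<=` V' by move=> ? [].
exists V2, (subset_trans V2V VU), (fun j => if j == i then res V2V' w else res V2V (z j)).
split=> // j; rewrite in_cons; case: eqP => [-> _|_ /= js].
  by rewrite -mapp_res wP (res_trans _ _ (subset_trans V2V VU)).
by rewrite -mapp_res zP // (res_trans _ _ (subset_trans V2V VU)).
Qed.

(** P describes local sections without selecting them: its uniqueness makes arbitrary local choices
    agree on overlaps. The conclusion speaks of all described sections, and so does not mention the
    chosen cover. *)
Lemma glue_description (F : omodule S) U
    (P : forall V, V `<=` U -> F V -> Prop) :
  (forall V V' (VU : V `<=` U) (V'V : V' `<=` V) (V'U : V' `<=` U) w,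
    P V VU w -> P V' V'U (res V'V w)) ->
  (forall V (VU : V `<=` U) w w', P V VU w -> P V VU w' -> w = w') ->
  (forall x, oset U x -> exists V (VU : V `<=` U) w, oset V x /\ P V VU w) ->
  exists! w : F U, forall V (VU : V `<=` U) w', P V VU w' -> res VU w = w'.
Proof.
move=> Pres Puniq Pex.
have /dep_choice [V /dep_choice [VU /dep_choice [w wP]]] : forall p : {x : S | oset U x},
    exists V (VU : V `<=` U) w, oset V (sval p) /\ P V VU w.
  by case=> x; apply: Pex.
have cov : U `<=` \bigcup_p V p.
  by move=> x Ux; exists (exist _ x Ux) => //; case: (wP (exist _ x Ux)).
have [|t [tP tU]] := res_gluing VU cov (s := w).
  move=> p q V' V'p V'q; apply: (Puniq _ (subset_trans V'p (VU p))).
    by apply: Pres; case: (wP p).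
  by apply: Pres; case: (wP q).
exists t; split=> [V' V'U w' Pw'|t' t'P]; last first.
  by apply: tU => p; apply: t'P; case: (wP p).
(* An arbitrary V' need not belong to the cover, so the equality is checked on its intersections
   with members of the cover. *)
apply: res_inj_pt => x V'x.
pose p : {x : S | oset U x} := exist _ x (V'U x V'x).
pose V2 := opensI V' (V p).
have V2V' : V2 `<=` V' by move=> ? [].
have V2p : V2 `<=` V p by move=> ? [].
exists V2, V2V'; split; first by split=> //; case: (wP p).
rewrite (res_trans _ _ (subset_trans V2V' V'U)) -(res_trans (VU p) V2p) tP.
apply: (Puniq _ (subset_trans V2V' V'U)); last exact: Pres Pw'.
by apply: Pres; case: (wP p).
Qed.

End Local.

(** * Orbit sums of words as generators of the symmetric tensors *)

Section SymmetricCoordinates.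
Context (S : ringed_space) (Q : omodule S) (T : forall m, tensor_power Q m).
Context (U : opens S) (r : nat) (e : 'I_r -> Q U) (eP : is_basis e).
Context (m : nat).
Implicit Types V : opens S.
Implicit Types I K : {ffun 'I_m -> 'I_r}.

Lemma word_multilinear K :
  multilinear (G := structure_sheaf S) (fun V (VU : V `<=` U) (q : 'I_m -> Q V) =>
    \prod_i coordinate eP VU (q i) (K i) : O V).
Proof.
split=> [V VU i a u v w uvw wi | V V' VU V'V V'U q]; last first.
  change (ores V'V (\prod_i coordinate eP VU (q i) (K i)) =
    \prod_i coordinate eP V'U (res V'V (q i)) (K i)).
  by rewrite rmorph_prod; apply: eq_bigr => i _; apply: coord_res.
change (\prod_i coordinate eP VU (w i) (K i) = a * \prod_i coordinate eP VU (u i) (K i) +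
  \prod_i coordinate eP VU (v i) (K i)).
rewrite !(bigD1 (P := predT) i) //= wi coord_linear mulrDl mulrA.
by congr (_ * _ + _ * _); apply: eq_bigr => j /uvw [uw vw]; rewrite ?uw ?vw.
Qed.

Definition word_coord K : mor_on U (T m) (structure_sheaf S) :=
  tens_lift T (word_multilinear K).

Definition word_tens K : T m U := tens (T m) (fun i => e (K i)).

(** On pure tensors this is the multilinear expansion of all factors in the basis. *)
Lemma word_decomp V (VU : V `<=` U) (x : T m V) :
  x = \sum_K (mor_app (word_coord K) VU x : O V) *: res VU (word_tens K).
Proof.
suff /(_ V VU x) : mor_eq (scalar_mor 1)
    (sum_mor (index_enum {ffun 'I_m -> 'I_r})
      (fun K => line_mor (word_coord K) (word_tens K))).
  by rewrite /= rmorph1 scale1r.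
apply: tens_ext => V' V'U q /=; rewrite rmorph1 scale1r.
rewrite [in LHS](_ : q = fun i =>
    \sum_j coordinate eP V'U (q i) j *: res V'U (e j)); last first.
  by apply/funext => i; apply: coordE.
rewrite tens_multilinear_sum; apply: eq_bigr => K _.
by rewrite tens_liftE tens_res.
Qed.

(** The permuted tensor pairs the factor [q (s i)] with the letter [K i]; reindexing the product by
    s moves the permutation to the word, as an inverse. *)
Lemma word_coord_perm V (VU : V `<=` U) K (s : 'S_m) (x : T m V) :
  mor_app (word_coord K) VU (mapp (tens_perm T s) x) =
  mor_app (word_coord [ffun i => K ((s^-1)%g i)]) VU x.
Proof.
suff /(_ V VU x) : mor_eq
    (comp_mor (word_coord K) (mor_restrict (tens_perm T s) U))
    (word_coord [ffun i => K ((s^-1)%g i)]) by [].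
apply: tens_ext => V' V'U q /=; rewrite tens_permE !tens_liftE.
rewrite [RHS](reindex_inj (@perm_inj _ s)); apply: eq_bigr => i _.
by rewrite ffunE permK.
Qed.

Definition same_orbit K := [pred L : {ffun 'I_m -> 'I_r} |
  [exists s : 'S_m, L == [ffun i => K (s i)]]].

(** [pick] depends only on the predicate, hence only on the orbit. The default is never reached,
    since K lies in its own orbit. *)
Definition orbit_rep K := odflt K [pick L | same_orbit K L].

Lemma orbit_repP K : exists s : 'S_m, orbit_rep K = [ffun i => K (s i)].
Proof.
rewrite /orbit_rep; case: pickP => [L /existsP[s /eqP ->]|_]; first by exists s.
by exists 1%g; apply/ffunP => i; rewrite ffunE perm1.
Qed.

Lemma orbit_rep_perm K (s : 'S_m) : orbit_rep [ffun i => K (s i)] = orbit_rep K.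
Proof.
have KK : same_orbit K K.
  by apply/existsP; exists 1%g; apply/eqP/ffunP => i; rewrite ffunE perm1.
have eqs : same_orbit [ffun i => K (s i)] =1 same_orbit K.
  move=> L; apply/existsP/existsP => -[u /eqP ->].
    by exists (u * s)%g; apply/eqP/ffunP => i; rewrite !ffunE permM.
  by exists (u * s^-1)%g; apply/eqP/ffunP => i; rewrite !ffunE permM permKV.
rewrite /orbit_rep (eq_pick eqs); case: pickP => [//|none].
by have := none K; rewrite KK.
Qed.

(* The empty sum unless K is the chosen representative of its orbit. *)
Definition orbit_tens K : T m U := \sum_(L | orbit_rep L == K) word_tens L.

(** Permuting the slots permutes the words with a given representative. *)
Lemma orbit_tens_sym K : symmetric_tensor (orbit_tens K).
Proof.
move=> s; rewrite linear_sum.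
pose act (L : {ffun 'I_m -> 'I_r}) : {ffun 'I_m -> 'I_r} := [ffun i => L (s i)].
have act_inj : injective act.
  move=> L L' /ffunP LL'; apply/ffunP => i.
  by have := LL' ((s^-1)%g i); rewrite !ffunE permKV.
rewrite [RHS](reindex_inj act_inj); apply: eq_big => [L|L _].
  by rewrite orbit_rep_perm.
by rewrite tens_permE; congr tens; apply/funext => i; rewrite ffunE.
Qed.

(** The word coordinates of a symmetric tensor are constant on orbits, so the words can be grouped
    by representative. *)
Lemma sym_decomp V (VU : V `<=` U) (x : Symt T m V) :
  x = \sum_K (mor_app (word_coord K) VU (sym_val x) : O V) *:
    res VU (mk_sym (orbit_tens_sym K)).
Proof.
apply: sym_valE; rewrite (linear_map_sum (@sym_val_linear _ _ _ _ _)).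
rewrite [LHS](word_decomp VU) (partition_big orbit_rep predT) //=.
apply: eq_bigr => K _; rewrite (linear_mapZ (@sym_val_linear _ _ _ _ _)).
rewrite [X in _ = _ *: X](_ : _ = res VU (orbit_tens K)) //.
rewrite /orbit_tens res_sum scaler_sumr; apply: eq_bigr => L /eqP LK; congr (_ *: _).
have [s KL] := orbit_repP L; rewrite -LK KL.
(* By symmetry x may be permuted by the inverse of s, which turns the coordinate at L into the one
   at its representative. *)
rewrite -[in LHS](sym_valP x (s^-1)%g) word_coord_perm.
rewrite (_ : [ffun i => _] = [ffun i => L (s i)]) //.
by apply/ffunP => i; rewrite !ffunE invgK.
Qed.

End SymmetricCoordinates.

(** * The trilinear expression behind both maps, and independence of lift and splitting *)

Section Maps.
Context (S : ringed_space) (R : oalgebra S) (I : rmodule R) (Q : omodule S)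
  (pi : mor I Q) (W : exterior_square Q).
Implicit Types U V : opens S.

Definition wedge_act U (a : Q U) (r : R U) (k : I U) : W U :=
  wedge W a (mapp pi (act I r k)).

Lemma wedge_linearl U (b : Q U) : linear (fun a => wedge W a b).
Proof.
have [h _ _] := wedge_bilinear W.
by move=> c x y; apply: (h U (@sub_openT _ U)).
Qed.

Lemma wedge_linearr U (a : Q U) : linear (wedge W a).
Proof.
have [_ h _] := wedge_bilinear W.
by move=> c x y; apply: (h U (@sub_openT _ U)).
Qed.

Lemma wedge_res U V (VU : V `<=` U) (a b : Q U) :
  res VU (wedge W a b) = wedge W (res VU a) (res VU b).
Proof.
have [_ _ h] := wedge_bilinear W.
exact: (h _ _ (@sub_openT _ U) VU (@sub_openT _ V)).
Qed.

Lemma wedge_anti U (a b : Q U) : wedge W a b + wedge W b a = 0.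
Proof.
have alt c : wedge W c c = 0 := wedge_alternating W (@sub_openT _ U) c.
have := alt (a + b); rewrite (linear_mapD (wedge_linearl _)).
by rewrite !(linear_mapD (wedge_linearr _)) !alt add0r addr0.
Qed.

Lemma act_linearl U (k : I U) : linear (fun r : R U => act I r k).
Proof.
have [h _ _] := act_bilinear I.
by move=> c x y; apply: (h U (@sub_openT _ U)).
Qed.

Lemma act_linearr U (r : R U) : linear (@act _ _ I U r).
Proof.
have [_ h _] := act_bilinear I.
by move=> c x y; apply: (h U (@sub_openT _ U)).
Qed.

Lemma wedge_act_linear1 U (r : R U) (k : I U) : linear (fun a => wedge_act a r k).
Proof. exact: wedge_linearl. Qed.

Lemma wedge_act_linear2 U (a : Q U) (k : I U) : linear (fun r => wedge_act a r k).
Proof.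
by move=> c x y; rewrite /wedge_act act_linearl linearP wedge_linearr.
Qed.

Lemma wedge_act_linear3 U (a : Q U) (r : R U) : linear (wedge_act a r).
Proof.
by move=> c x y; rewrite /wedge_act act_linearr linearP wedge_linearr.
Qed.

Lemma wedge_act_res U V (VU : V `<=` U) (a : Q U) (r : R U) (k : I U) :
  res VU (wedge_act a r k) = wedge_act (res VU a) (res VU r) (res VU k).
Proof.
rewrite /wedge_act wedge_res mapp_res; congr (wedge W _ (mapp pi _)).
have [_ _ h] := act_bilinear I.
exact: (h _ _ (@sub_openT _ U) VU (@sub_openT _ V)).
Qed.

Lemma wedge_act_scalar U (a : Q U) (c : O U) (k : I U) :
  wedge_act a (c *: aone R U) k = c *: wedge W a (mapp pi k).
Proof. by rewrite (linear_mapZ (wedge_act_linear2 _ _)) /wedge_act act1. Qed.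

(** Locally r is a scalar c, and the expression becomes c times a /\ a. This treats the diagonal
    terms. *)
Lemma wedge_act_unit U (a : Q U) (r : R U) (k : I U) :
  in_image (aunit R) r -> mapp pi k = a -> wedge_act a r k = 0.
Proof.
move=> rP ka; apply: res_inj_pt => x /rP[V [VU [c [Vx cr]]]].
exists V, VU; split=> //; rewrite wedge_act_res res_is_linear0 -cr -ka.
rewrite [X in wedge_act _ X](_ : _ = (c : O V) *: aone R V) // wedge_act_scalar.
by rewrite mapp_res (wedge_alternating W (@sub_openT _ V)) scaler0.
Qed.

(** Locally r is a scalar c, and the sum becomes c (a /\ b + b /\ a). This treats the pair of
    off-diagonal terms. *)
Lemma wedge_act_unit_swap U (a b : Q U) (r : R U) (k l : I U) :
  in_image (aunit R) r -> mapp pi k = a -> mapp pi l = b ->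
  wedge_act a r l + wedge_act b r k = 0.
Proof.
move=> rP ka lb; apply: res_inj_pt => x /rP[V [VU [c [Vx cr]]]].
exists V, VU; split=> //; rewrite resD !wedge_act_res res_is_linear0 -cr.
rewrite [mapp _ _](_ : _ = (c : O V) *: aone R V) // !wedge_act_scalar.
by rewrite -!mapp_res ka lb -scalerDr wedge_anti scaler0.
Qed.

Context (T : forall m, tensor_power Q m) (m : nat).
Context (C : cokernel (aunit R)) (phi : mor (Symt T m) C).

Section Independence.
Context (U : opens S) (e : 'I_2 -> Q U) (eP : is_basis e).
Let UU := @subset_refl _ U.

(** The outer factors are expanded in the basis and the coefficients collected by [middle_rep]; the
    right side no longer refers to the expression of t. *)
Lemma wedge_act_middle (f : {linear Symt T m U -> R U}) (s : {linear Q U -> I U})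
    (t : Symt T m.+2 U) (N : nat) (a : 'I_N -> Q U) (x : 'I_N -> Symt T m U)
    (b : 'I_N -> Q U) :
  sym_val t = \sum_i lcat (a i) (rcat (sym_val (x i)) (b i)) ->
  \sum_i wedge_act (a i) (f (x i)) (s (b i)) =
  \sum_j \sum_l wedge_act (e j) (f (middle eP t j l)) (s (e l)).
Proof.
move=> tE.
transitivity (\sum_i \sum_j \sum_l (coordinate eP UU (a i) j * coordinate eP UU (b i) l) *:
    wedge_act (e j) (f (x i)) (s (e l))).
  apply: eq_bigr => i _; rewrite {1}[a i](coordE1 eP).
  rewrite (linear_map_sum (wedge_act_linear1 _ _)); apply: eq_bigr => j _.
  rewrite (linear_mapZ (wedge_act_linear1 _ _)) {1}[b i](coordE1 eP) linear_sum.
  rewrite (linear_map_sum (wedge_act_linear3 _ _)) scaler_sumr.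
  apply: eq_bigr => l _.
  by rewrite linearZ (linear_mapZ (wedge_act_linear3 _ _)) scalerA.
rewrite exchange_big; apply: eq_bigr => j _; rewrite exchange_big.
apply: eq_bigr => l _; rewrite (middle_rep eP tE) linear_sum.
rewrite (linear_map_sum (wedge_act_linear2 _ _)); apply: eq_bigr => i _.
by rewrite linearZ (linear_mapZ (wedge_act_linear2 _ _)).
Qed.

Lemma middle_lift_indep (f f' : Symt T m U -> R U) (s : Q U -> I U)
    (t : Symt T m.+2 U) :
  (forall x, mapp (coker_proj C) (f x) = mapp phi x) ->
  (forall x, mapp (coker_proj C) (f' x) = mapp phi x) ->
  (forall q, mapp pi (s q) = q) ->
  \sum_j \sum_l wedge_act (e j) (f (middle eP t j l)) (s (e l)) =
  \sum_j \sum_l wedge_act (e j) (f' (middle eP t j l)) (s (e l)).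
Proof.
move=> fP f'P sP; apply/eqP; rewrite -subr_eq0 -sumrB; apply/eqP.
under eq_bigr => j _.
  rewrite -sumrB.
  under eq_bigr => l _ do rewrite -(linear_mapB (wedge_act_linear2 _ _)).
  over.
have d_unit x : in_image (aunit R) (f x - f' x).
  by apply/(coker_ker C); rewrite linearB /= fP f'P subrr.
(* Rank two leaves four terms. The two diagonal ones vanish singly; the other two share one
   coefficient by [middleC] and cancel. *)
rewrite !big_ord_recl !big_ord0 !addr0 (middleC eP t (lift ord0 ord0) ord0).
rewrite wedge_act_unit // add0r addrA.
by rewrite wedge_act_unit_swap // add0r wedge_act_unit.
Qed.

Lemma middle_splitting_indep (P : tensor_product (Symt T m.+1) (kernel pi))
    (mu : mor P W) (mu_first : is_first_map phi mu)
    (mu0 : forall (V : opens S) (z : P V), mapp mu z = 0)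
    (f : Symt T m U -> R U) (s s' : Q U -> I U) (t : Symt T m.+2 U) :
  (forall x, mapp (coker_proj C) (f x) = mapp phi x) ->
  (forall q, mapp pi (s q) = q) -> (forall q, mapp pi (s' q) = q) ->
  \sum_j \sum_l wedge_act (e j) (f (middle eP t j l)) (s (e l)) =
  \sum_j \sum_l wedge_act (e j) (f (middle eP t j l)) (s' (e l)).
Proof.
move=> fP sP s'P; rewrite exchange_big [RHS]exchange_big.
apply: eq_bigr => l _; apply/eqP; rewrite -subr_eq0 -sumrB; apply/eqP.
have kP : equalizer (fun _ : unit => pi) (fun=> zero_mor I Q) U (s (e l) - s' (e l)).
  by move=> _; rewrite linearB /= sP s'P subrr.
(* For fixed l, the sum over j is the first map at the contraction of the last slot of t, tensored
   with the difference of the two splittings at [e l]. *)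
rewrite -[RHS](mu0 _ (tmul P (sym_contr eP ord_max l t) (sub_mk kP))).
rewrite (mu_first U _ (sub_mk kP) 2 e (fun j => middle eP t j l)
  (fun j => f (middle eP t j l)) (fun j => fP _) (sym_contr_lcat eP _)).
by apply: eq_bigr => j _; rewrite -(linear_mapB (wedge_act_linear3 _ _)).
Qed.

End Independence.
End Maps.

(** * Local charts, uniqueness of values, and the glued second map *)

Section Gluing.
Context (S : ringed_space) (R : oalgebra S) (I : rmodule R) (Q : omodule S)
  (Q_free : locally_free 2 Q) (pi : mor I Q) (pi_epi : epi pi)
  (T : forall k, tensor_power Q k) (W : exterior_square Q)
  (C : cokernel (aunit R)) (m : nat) (phi : mor (Symt T m) C).
Implicit Types U V : opens S.

(** The basis vectors have preimages in I near x, and the coordinates extend this choice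
    linearly. *)
Lemma local_splitting U (e : 'I_2 -> Q U) : is_basis e -> forall x, oset U x ->
  exists V (VU : V `<=` U) (s : mor_on V Q I), oset V x /\ is_splitting pi s.
Proof.
move=> eP x Ux.
have [|V [VU [z [Vx zP]]]] := @in_image_fin _ _ _ pi U _ e _ x Ux.
  by move=> j; apply: pi_epi.
have eVP := is_basis_res VU eP.
exists V, VU, (sum_mor (index_enum 'I_2)
  (fun l => line_mor (coord_mor eVP l) (z l))); split=> // V' V'V q.
rewrite /= linear_sum [RHS](coordE eVP V'V); apply: eq_bigr => l _.
by rewrite linearZ /= -mapp_res zP.
Qed.

Definition sym_val_mor k U : mor_on U (Symt T k) (T k) :=
  @mk_mor S U (Symt T k) (T k) (fun V _ x => sym_val x)
    (fun V _ => @sym_val_linear _ _ T V k) (fun _ _ _ _ _ _ => erefl).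

(** The images under phi of the finitely many orbit sums lift to R near x; by [sym_decomp] the word
    coordinates extend this choice to a linear lift. *)
Lemma local_lift U (e : 'I_2 -> Q U) : is_basis e -> forall x, oset U x ->
  exists V (VU : V `<=` U) (f : mor_on V (Symt T m) R), oset V x /\ is_lift phi f.
Proof.
move=> eP x Ux.
pose y (K : {ffun 'I_m -> 'I_2}) := mapp phi (mk_sym (orbit_tens_sym T e K)).
have [|V [VU [z [Vx zP]]]] := @in_image_fin _ _ _ (coker_proj C) U _ y _ x Ux.
  by move=> K; apply: coker_epi.
exists V, VU, (sum_mor (index_enum {ffun 'I_m -> 'I_2}) (fun K =>
  line_mor (comp_mor (sub_mor VU (word_coord T eP K)) (sym_val_mor m V)) (z K))).
split=> // V' V'V t.
rewrite [in RHS](sym_decomp eP (subset_trans V'V VU) t) /= !linear_sum.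
apply: eq_bigr => K _; rewrite !linearZ /= -mapp_res zP -mapp_res.
by rewrite (res_trans _ _ (subset_trans V'V VU)).
Qed.

Lemma exists_chart U x : oset U x ->
  exists V (VU : V `<=` U) (e : 'I_2 -> Q V) (f : mor_on V (Symt T m) R)
    (s : mor_on V Q I),
  [/\ oset V x, is_basis e, is_lift phi f & is_splitting pi s].
Proof.
move=> Ux; have [U0 [e0 [U0x e0P]]] := Q_free x.
have [V1 [V1U0 [f [V1x fP]]]] := local_lift e0P U0x.
have [V2 [V2U0 [s [V2x sP]]]] := local_splitting e0P U0x.
pose V := opensI U (opensI V1 V2).
have VU : V `<=` U by move=> ? [].
have VV1 : V `<=` V1 by move=> ? [_ []].
have VV2 : V `<=` V2 by move=> ? [_ []].
exists V, VU, (fun j => res (subset_trans VV1 V1U0) (e0 j)), (sub_mor VV1 f),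
  (sub_mor VV2 s); split=> //.
- exact: is_basis_res.
- by move=> V' V'V y; apply: fP.
- by move=> V' V'V q; apply: sP.
Qed.

(** The lift and the splitting live over some open set containing V, so that they serve unchanged
    after restriction to a smaller set. As every choice is existential, uniqueness of the value is
    the well-definedness. *)
Definition is_value V (t : Symt T m.+2 V) (w : W V) :=
  exists U (f : mor_on U (Symt T m) R) (s : mor_on U Q I) (VU : V `<=` U) N
    (a : 'I_N -> Q V) (x : 'I_N -> Symt T m V) (b : 'I_N -> Q V),
  [/\ is_lift phi f, is_splitting pi s,
    sym_val t = \sum_i lcat (a i) (rcat (sym_val (x i)) (b i)) &
    w = \sum_i wedge_act pi W (a i) (mor_app f VU (x i)) (mor_app s VU (b i))].

Lemma is_value_res U V (VU : V `<=` U) (t : Symt T m.+2 U) w :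
  is_value t w -> is_value (res VU t) (res VU w).
Proof.
move=> [U0 [f [s [UU0 [N [a [x [b [fP sP tE ->]]]]]]]]].
exists U0, f, s, (subset_trans VU UU0), N, (fun i => res VU (a i)),
  (fun i => res VU (x i)), (fun i => res VU (b i)); split=> //.
  transitivity (res VU (sym_val t)) => //; rewrite tE res_sum.
  by apply: eq_bigr => i _; rewrite /lcat /rcat !tens_insert_res.
rewrite res_sum; apply: eq_bigr => i _; rewrite wedge_act_res.
by rewrite !(mor_res _ _ _ (subset_trans VU UU0)).
Qed.

(** The formula at the canonical expression of t in the basis, which makes linearity in t
    visible. *)
Definition chart_value V (e : 'I_2 -> Q V) (eP : is_basis e)
    (f : mor_on V (Symt T m) R) (s : mor_on V Q I) (t : Symt T m.+2 V) : W V :=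
  \sum_j \sum_l wedge_act pi W (e j) (mor_app f (@subset_refl _ V) (middle eP t j l))
    (mor_app s (@subset_refl _ V) (e l)).

Lemma middle_linear V (e : 'I_2 -> Q V) (eP : is_basis e) j l :
  linear (fun t : Symt T m.+2 V => middle eP t j l).
Proof. by move=> a t t'; rewrite /middle !sym_contr_linear. Qed.

Lemma chart_value_linear V (e : 'I_2 -> Q V) (eP : is_basis e) f s :
  linear (chart_value eP f s).
Proof.
move=> a t t'; rewrite /chart_value scaler_sumr -big_split; apply: eq_bigr => j _.
rewrite scaler_sumr -big_split; apply: eq_bigr => l _.
by rewrite middle_linear linearP wedge_act_linear2.
Qed.

Lemma chart_value_is_value V (e : 'I_2 -> Q V) (eP : is_basis e)
    (f : mor_on V (Symt T m) R) (s : mor_on V Q I) (t : Symt T m.+2 V) :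
  is_lift phi f -> is_splitting pi s -> is_value t (chart_value eP f s t).
Proof.
(* p enumerates the pairs (j, l), since [is_value] takes a sum indexed by an ordinal type. *)
move=> fP sP; pose p := @enum_val ('I_2 * 'I_2)%type predT.
have pb : {on predT, bijective p} by apply: onW_bij; apply: enum_val_bij.
exists V, f, s, (@subset_refl _ V), #|{: 'I_2 * 'I_2}|, (fun i => e (p i).1),
  (fun i => middle eP t (p i).1 (p i).2), (fun i => e (p i).2); split=> //.
  rewrite [LHS](middle_decomp eP) pair_bigA (reindex p) //.
by rewrite /chart_value pair_bigA (reindex p).
Qed.

Context (P : tensor_product (Symt T m.+1) (kernel pi))
    (mu : mor P W) (mu_first : is_first_map phi mu)
    (mu0 : forall U (z : P U), mapp mu z = 0).

(** Near each point a basis brings both values into canonical form, where lift and splitting can be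
    exchanged. *)
Lemma is_value_unique V (t : Symt T m.+2 V) w w' :
  is_value t w -> is_value t w' -> w = w'.
Proof.
move=> tw tw'; apply: res_inj_pt => x Vx.
have [V' [V'V [e [_ [_ [V'x eP _ _]]]]]] := exists_chart Vx.
exists V', V'V; split=> //.
have [U1 [f1 [s1 [VU1 [N1 [a1 [x1 [b1 [f1P s1P t1E ->]]]]]]]]] := is_value_res V'V tw.
have [U2 [f2 [s2 [VU2 [N2 [a2 [x2 [b2 [f2P s2P t2E ->]]]]]]]]] := is_value_res V'V tw'.
rewrite (wedge_act_middle pi W eP _ _ t1E) (wedge_act_middle pi W eP _ _ t2E).
(* First f1 is replaced by f2 with s1 kept, then s1 by s2 with f2 kept. *)
rewrite (middle_lift_indep W eP (f := mor_app f1 VU1) (f' := mor_app f2 VU2) _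
  (f1P _ VU1) (f2P _ VU2) (s1P _ VU1)).
exact: (middle_splitting_indep eP mu_first mu0 _ (f2P _ VU2) (s1P _ VU1) (s2P _ VU2)).
Qed.

Lemma exists_value U (t : Symt T m.+2 U) : exists! w : W U,
  forall V (VU : V `<=` U) w', is_value (res VU t) w' -> res VU w = w'.
Proof.
apply: glue_description.
- move=> V V' VU V'V V'U w /(is_value_res V'V).
  by rewrite (res_trans _ _ V'U).
- by move=> V VU w w'; apply: is_value_unique.
move=> x /exists_chart [V [VU [e [f [s [Vx eP fP sP]]]]]].
exists V, VU, (chart_value eP f s (res VU t)); split=> //.
exact: chart_value_is_value.
Qed.

Definition second_fun U (t : Symt T m.+2 U) : W U := sval (cid (exists_value t)).

Lemma second_funP U (t : Symt T m.+2 U) V (VU : V `<=` U) w :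
  is_value (res VU t) w -> res VU (second_fun t) = w.
Proof. by rewrite /second_fun; case: cid => v [vP _] /=; apply: vP. Qed.

(** Linearity is local, and over a chart the function is [chart_value]. *)
Lemma second_fun_linear U : linear (@second_fun U).
Proof.
move=> a t t'; apply: res_inj_pt => x.
move=> /exists_chart [V [VU [e [f [s [Vx eP fP sP]]]]]].
exists V, VU; split=> //.
have val_t t0 : res VU (second_fun t0) = chart_value eP f s (res VU t0).
  by apply: second_funP; apply: chart_value_is_value.
by rewrite res_linear !val_t res_linear chart_value_linear.
Qed.

Lemma second_fun_res U V (VU : V `<=` U) (t : Symt T m.+2 U) :
  res VU (second_fun t) = second_fun (res VU t).
Proof.
apply: res_inj_pt => x /exists_chart [V' [V'V [e [f [s [Vx eP fP sP]]]]]].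
exists V', V'V; split=> //; rewrite (res_trans _ _ (subset_trans V'V VU)).
have value := chart_value_is_value eP (res V'V (res VU t)) fP sP.
rewrite (second_funP value) (second_funP (w := chart_value eP f s (res V'V (res VU t)))) //.
by rewrite -(res_trans VU V'V).
Qed.

Definition second_map : mor (Symt T m.+2) W :=
  @mk_mor S (openT S) (Symt T m.+2) W (fun V _ => @second_fun V)
    (fun V _ => @second_fun_linear V)
    (fun V V' _ V'V _ t => second_fun_res V'V t).

Lemma second_mapP : is_second_map_for_all_choices pi phi second_map.
Proof.
move=> U f s fP sP V VU t N a x b tE.
rewrite -[LHS](res_refl (@subset_refl _ V)); apply: second_funP.
by rewrite res_refl; exists U, f, s, VU, N, a, x, b.
Qed.

Lemma second_map_indep U (f f' : mor_on U (Symt T m) R) (s s' : mor_on U Q I)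
    (Psi Psi' : mor_on U (Symt T m.+2) W) :
  is_lift phi f -> is_lift phi f' -> is_splitting pi s -> is_splitting pi s' ->
  is_second_map pi f s Psi -> is_second_map pi f' s' Psi' -> mor_eq Psi Psi'.
Proof.
move=> fP f'P sP s'P PsiP Psi'P V VU t; apply: res_inj_pt => x Vx.
have [V' [V'V [e [g [r [V'x eP gP rP]]]]]] := exists_chart Vx.
exists V', V'V; split=> //.
have V'U := subset_trans V'V VU.
(* Only the expression of t is kept from the chart; the values are computed with the given lifts and
   splittings. *)
have [_ [_ [_ [_ [N [a [y [b [_ _ tE _]]]]]]]]] :=
  chart_value_is_value eP (res V'V t) gP rP.
rewrite !(mor_res _ _ _ V'U).
rewrite (PsiP V' V'U _ _ _ _ _ tE) (Psi'P V' V'U _ _ _ _ _ tE).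
apply: (@is_value_unique _ (res V'V t)).
  by exists U, f, s, V'U, N, a, y, b.
by exists U, f', s', V'U, N, a, y, b.
Qed.

(** Lifts and splittings are available over charts, where one choice of both serves the two maps. *)
Lemma second_map_unique (Psi Psi' : mor (Symt T m.+2) W) :
  is_second_map_for_all_choices pi phi Psi ->
  is_second_map_for_all_choices pi phi Psi' -> mor_eq Psi Psi'.
Proof.
move=> PsiP Psi'P V VU t; apply: res_inj_pt => x Vx.
have [V' [V'V [e [f [s [V'x eP fP sP]]]]]] := exists_chart Vx.
exists V', V'V; split=> //.
rewrite !(mor_res _ _ _ (@sub_openT _ V')).
exact: (second_map_indep fP fP sP sP (PsiP _ _ _ fP sP) (Psi'P _ _ _ fP sP)
  (@subset_refl _ V')).
Qed.

End Gluing.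

(* n is m.+2 *)
Theorem lemma4p5 (m : nat) (hn : (3 <= m.+2)%N)
    (S : ringed_space) (hS : is_scheme S)
    (R : oalgebra S) (I : rmodule R)
    (Q : omodule S) (hQ : locally_free 2 Q)
    (pi : mor I Q) (hpi : epi pi)
    (T : forall k : nat, tensor_power Q k)
    (W : exterior_square Q)
    (C : cokernel (aunit R))
    (phi : mor (Symt T m) C) (hphi : isomorphism phi)
    (P : tensor_product (Symt T m.+1) (kernel pi))
    (mu : mor P W) (hmu : is_first_map phi mu)
    (mu0 : forall (U : opens S) (z : P U), mapp mu z = 0) :
  (exists Psi : mor (Symt T m.+2) W,
    is_second_map_for_all_choices pi phi Psi /\
    forall Psi' : mor (Symt T m.+2) W,
      is_second_map_for_all_choices pi phi Psi' -> mor_eq Psi' Psi) /\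
  (forall (U : opens S) (f f' : mor_on U (Symt T m) R) (s s' : mor_on U Q I)
      (Psi Psi' : mor_on U (Symt T m.+2) W),
    is_lift phi f -> is_lift phi f' ->
    is_splitting pi s -> is_splitting pi s' ->
    is_second_map pi f s Psi -> is_second_map pi f' s' Psi' ->
    mor_eq Psi Psi').
Proof.
split; last by move=> U f f' s s' Psi Psi'; apply: (second_map_indep hQ hpi hmu mu0).
exists (second_map hQ hpi hmu mu0).
have second := @second_mapP _ _ _ _ hQ _ hpi _ _ _ _ _ _ _ hmu mu0.
split=> // Psi' Psi'P.
exact: (second_map_unique hQ hpi hmu mu0 Psi'P second).
Qed.
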